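(* Let $(B,x,y,z)=(B[1],x[1],y[1],z[1])\xrightarrow{\mu_{k_1}}(B[2],x[2],y[2],z[2])\xrightarrow{\mu_{k_2}}\cdots\xrightarrow{\mu_{k_m}}(B[m+1],x[m+1],y[m+1],z[m+1])$ be a sequence of mutations of seeds of generalized cluster type, of rank $n$ and mutation degree $d=(d_i)_{i=1}^n$, with coefficient semifield $\mathbb{Q}_+(y,z)$, where $B$ and $x$ are arbitrary and the initial $y$ and $z$ are the generators of $\mathbb{Q}_+(y,z)$. Suppose that the sequence is $\sigma$-periodic for some permutation $\sigma$ of $\{1,\dots,n\}$. Let $\varphi:\mathbb{Q}_+(y,z)\to\mathbb{R}_+$ be any semifield homomorphism such that for every $i=1,\dots,n$ the tuple $\varphi(z_i)=(\varphi(z_{i,s}))_{s=0}^{d_i}$ satisfies the generic condition. Then the identity $$\sum_{t=1}^{m}\tilde r_{k_t}\,\tilde L_{d_{k_t},\varphi(z_{k_t}[t])}\bigl(\varphi(y_{k_t}[t])\bigr)=\sum_{t=1}^{m}\tilde r_{k_t}\,\frac{1-\varepsilon_t}{2}\,\tilde L_{d_{k_t},\varphi(z_{k_t}[t])}(\infty)$$ is equivalent to the identity $$\sum_{t=1}^{m}\varepsilon_t\,\tilde r_{k_t}\,\tilde L_{d_{k_t},\varphi((z_{k_t}[t])^{\circ})}\bigl(\varphi((y_{k_t}[t])^{\varepsilon_t})\bigr)=0,$$ where $\varepsilon_t\in\{1,-1\}$ is the tropical sign of $y_{k_t}[t]$, and $(z_{k_t}[t])^{\circ}=z_{k_t}[t]$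 if $\varepsilon_t=1$, while $(z_{k_t}[t])^{\circ}=(z_{k_t}[t])^{*}$ if $\varepsilon_t=-1$.
   Context: For an integer $a$, $[a]_+=\max(a,0)$. $\mathbb{R}_+$ is the set of positive real numbers, a semifield under usual product and sum. Rogers dilogarithm of higher degree. Let $\delta\ge 1$ be an integer and $\zeta=(\zeta_s)_{s=0}^{\delta}$ with $\zeta_0=\zeta_\delta=1$ and $\zeta_1,\dots,\zeta_{\delta-1}\in\mathbb{R}_{\ge0}$. Put $P_{\delta,\zeta}(x)=\sum_{s=0}^{\delta}\zeta_s x^s$. Generic condition for $\zeta$: $P_{\delta,\zeta}$ has no root on $\mathbb{R}$ except possibly $x=-1$. Under this condition define, for $x\ge 0$, $$\tilde L_{\delta,\zeta}(x)=\frac12\int_0^x\left\{\frac{\log P_{\delta,\zeta}(y)}{y}-\frac{\log y}{P_{\delta,\zeta}(y)}P'_{\delta,\zeta}(y)\right\}dy,$$ and $\tilde L_{\delta,\zeta}(\infty)=\lim_{x\to\infty}\tilde L_{\delta,\zeta}(x)$. The reverse of a tuple $\zeta=(\zeta_s)_{s=0}^\delta$ is $\zeta^*=(\zeta_{\delta-s})_{s=0}^{\delta}$. Semifields. A semifield is a multiplicative abelian group $\mathbb{P}$ with a commutative, associative operation $\oplus$ satisfying $a(b\oplus c)=ab\oplus ac$. Its group ring $\mathbb{Z}[\mathbb{P}]$ is a domain with fraction field $\mathbb{Q}(\mathbb{P})$. Fix $n\ge1$ and positive integers $d=(d_i)_{i=1}^n$. Let $y=(y_i)_{i=1}^n$ and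 $z=(z_{i,s})_{1\le i\le n,\,0\le s\le d_i}$ be commuting formal variables, except that $z_{i,0}=z_{i,d_i}=1$. $\mathbb{Q}_+(y,z)$ is the semifield of all rational functions in $y,z$ that can be written as a quotient of two nonzero polynomials with nonnegative integer coefficients, with the usual product and sum. $\mathrm{Trop}(y,z)$ is the semifield of Laurent monomials in the variables $y_i,z_{i,s}$ (again $z_{i,0}=z_{i,d_i}=1$), with the usual product and with $\oplus$ taking the minimum of the exponents of each variable. Seeds and mutations. Put $\mathbb{P}=\mathbb{Q}_+(y,z)$ and $\mathcal{F}=(\mathbb{Q}(\mathbb{P}))(w_1,\dots,w_n)$ with formal variables $w_i$. A seed $(B,x,y,z)$ consists of: an integer $n\times n$ matrix $B=(b_{ij})$ that is skew-symmetrizable, i.e. there is a diagonal matrix $R=\mathrm{diag}(r_1,\dots,r_n)$ with positive integer entries (a skew-symmetrizer) with $RB$ skew-symmetric; an $n$-tuple $x$ of algebraically independent elements of $\mathcal{F}$; an $n$-tuple $y$ of elements of $\mathbb{P}$; and $z=(z_{i,s})$, elements of $\mathbb{P}$ with $z_{i,0}=z_{i,d_i}=1$. Put $z_k=(z_{k,s})_{s=0}^{d_k}$, $\hat y_i=y_i\prod_j x_j^{b_{ji}}\in\mathcal{F}$, $P_{d_k,z_k}(\hat y_k)=\sum_{s} z_{k,s}\hat y_k^s\in\mathcal F$ and $P_{d_k,z_k}(y_k)|_{\mathbb{P}}=\bigoplus_{s} z_{k,s}y_k^s\in\mathbb P$. The mutation $(B',x',y',z')=\mu_k(B,x,y,z)$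 at $k$ is: $b'_{ij}=-b_{ij}$ if $i=k$ or $j=k$, and $b'_{ij}=b_{ij}+d_k([-b_{ik}]_+b_{kj}+b_{ik}[b_{kj}]_+)$ otherwise; $x'_k=x_k^{-1}\bigl(\prod_j x_j^{[-b_{jk}]_+}\bigr)^{d_k}P_{d_k,z_k}(\hat y_k)/P_{d_k,z_k}(y_k)|_{\mathbb{P}}$ and $x'_i=x_i$ for $i\ne k$; $y'_k=y_k^{-1}$ and $y'_i=y_i\bigl(y_k^{[b_{ki}]_+}\bigr)^{d_k}\bigl(P_{d_k,z_k}(y_k)|_{\mathbb{P}}\bigr)^{-b_{ki}}$ for $i\neq k$; $z'_{k,s}=z_{k,d_k-s}$ and $z'_{i,s}=z_{i,s}$ for $i\ne k$. The sequence is $\sigma$-periodic if $b_{\sigma(i)\sigma(j)}[m+1]=b_{ij}$, $x_{\sigma(i)}[m+1]=x_i$, $y_{\sigma(i)}[m+1]=y_i$ for all $i,j$. $R=\mathrm{diag}(r_1,\dots,r_n)$ is a common skew-symmetrizer of $B[1],\dots,B[m+1]$ (a skew-symmetrizer of $B$ is one for all of them), $r=\mathrm{lcm}(r_1,\dots,r_n)$, and $\tilde r_i=r/r_i$. Notation $z_k[t]=(z_{k,s}[t])_{s=0}^{d_k}$, and $\varphi$ is applied to tuples entrywise. Tropical signs. Let $\pi:\mathbb{Q}_+(y,z)\to\mathrm{Trop}(y,z)$ be the semifield homomorphism with $y_i\mapsto y_i$, $z_{i,s}\mapsto z_{i,s}$. It is known that $\pi(y_i[t])$ does not involve $z$, so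 $\pi(y_i[t])=\prod_{j=1}^n y_j^{c_{ji}[t]}$ with integers $c_{ji}[t]$; equivalently $c_{ij}[1]=\delta_{ij}$, $c_{ik_t}[t+1]=-c_{ik_t}[t]$, and $c_{ij}[t+1]=c_{ij}[t]+d_{k_t}([-c_{ik_t}[t]]_+b_{k_tj}[t]+c_{ik_t}[t][b_{k_tj}[t]]_+)$ for $j\ne k_t$. The $c$-vector of $y_i[t]$ is $c_i[t]=(c_{ji}[t])_{j=1}^n$. It is known (sign coherence) that each $c$-vector is nonzero with all components nonnegative or all nonpositive; the tropical sign of $y_i[t]$ is $1$ in the first case and $-1$ in the second, and $\varepsilon_t$ is the tropical sign of $y_{k_t}[t]$. *)

(* Defs.v *)
From HB Require Import structures.
From mathcomp Require Import all_boot all_order all_algebra perm.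
(* The notations of multinomials clash with those of MathComp-Analysis. *)
From mathcomp Require mpoly monalg.
Import -(notations) mpoly.
Import -(notations) monalg.
From mathcomp Require Import finmap all_classical all_reals all_analysis.
From mathcomp Require Import zify.

Set Implicit Arguments.
Unset Strict Implicit.
Unset Printing Implicit Defensive.

Import Order.TTheory GRing.Theory Num.Theory.
Import numFieldNormedType.Exports.

Local Open Scope ring_scope.

HB.mixin Record Group_isSemifield P of Group P := {
  oplus : P -> P -> P;
  smulC : commutative ( *%g : P -> P -> P);
  oplusA : associative oplus;
  oplusC : commutative oplus;
  smulDr : right_distributive ( *%g : P -> P -> P) oplus
}.

#[short(type="semifieldType")]
HB.structure Definition Semifield := {P of Group_isSemifield P & Group P}.

Notation "a \oplus b" := (oplus a b) (at level 50, left associativity).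

Definition semifield_hom (P Q : semifieldType) (f : P -> Q) : Prop :=
  {morph f : a b / (a * b)%g} /\ {morph f : a b / a \oplus b}.

(* A semifield has no zero, so the sum is folded from its first term. *)
Definition oplus_sum (P : semifieldType) (d : nat) (F : 'I_d.+1 -> P) : P :=
  foldl oplus (F ord0) [seq F (lift ord0 s) | s <- enum 'I_d].

Definition gexpz (P : semifieldType) (a : P) (e : int) : P :=
  match e with Posz k => (a ^+ k)%g | Negz k => (a ^- k.+1)%g end.

Section SemifieldOrder.
Variable P : semifieldType.
Implicit Types a b c : P.
Local Open Scope group_scope.

Lemma semifield_torsion_free a n : a ^+ n.+1 = 1 -> a = 1.
Proof.
case: n => [//|n] an1.
pose fix pw i : P := if i is j.+1 then pw j \oplus a ^+ j.+1 else 1.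
have shift i : 1 \oplus a * pw i = pw i.+1.
  elim: i => [|i IH]; first by rewrite /= mulg1 expg1.
  by rewrite [pw i.+1]/= smulDr oplusA IH -expgS.
have fixS : a * pw n.+1 = pw n.+1.
  by rewrite [pw n.+1]/= smulDr -expgS an1 oplusC shift.
by apply: (can_inj (mulgK (pw n.+1))); rewrite fixS mul1g.
Qed.

Definition strict_cone (C : set P) : Prop :=
  (forall a b, C a -> C b -> C (a * b)) /\ ~ C 1.

Lemma cone_expg (C : set P) a n : strict_cone C -> C a -> C (a ^+ n.+1).
Proof.
move=> [CM _] Ca; elim: n => [|n IH]; first by rewrite expg1.
by rewrite expgS; apply: CM.
Qed.

Lemma maximal_cone_has (C : set P) a : strict_cone C ->
  (forall B : set P, (C `<` B)%classic -> ~ strict_cone B) ->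
  ~ C a -> a <> 1 -> exists n, C (a^-1 ^+ n.+1).
Proof.
move=> Ccone Cmax nCa a1.
pose B : set P := fun x => exists c k, x = c * a ^+ k /\ (C c \/ c = 1 /\ (0 < k)%N).
have CB : (C `<` B)%classic.
  split=> [x Cx|/(_ a) BC]; first by exists x, 0%N; rewrite mulg1; split => //; left.
  by apply: nCa; apply: BC; exists 1, 1%N; rewrite mul1g; split => //; right.
have BM x y : B x -> B y -> B (x * y).
  move=> [c [k [-> hc]]] [c' [k' [-> hc']]].
  have -> : c * a ^+ k * (c' * a ^+ k') = (c * c') * a ^+ (k + k').
    rewrite expgnDr mulgA -[in LHS](mulgA c) (smulC (a ^+ k)).
    by rewrite !mulgA.
  exists (c * c'), (k + k')%N; split => //.
  case: hc hc' => [Cc|[-> k0]] [Cc'|[-> k0']].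
  - by left; apply: (proj1 Ccone).
  - by left; rewrite mulg1.
  - by left; rewrite mul1g.
  - by right; rewrite mul1g addn_gt0 k0.
have : B 1 by apply: contrapT => nB1; apply: (Cmax B CB).
move=> [c [[|k] [e hc]]].
  by case: hc => [|[]//]; rewrite mulg1 in e; rewrite -e => /(proj2 Ccone).
exists k; case: hc => [Cc|[c1 _]]; last first.
  by case: a1; apply: (@semifield_torsion_free _ k); rewrite e c1 mul1g.
by rewrite expVgn -[X in C X]mul1g e mulgK.
Qed.

(* A maximal strict cone is the positive cone of a total group order. *)
Lemma total_cone : exists C : set P,
  strict_cone C /\ forall a, a <> 1 -> C a \/ C a^-1.
Proof.
have [|C [Ccone Cmax]] := @Zorn_bigcup P strict_cone.
  move=> F FS Ftot; split.
  - move=> a b [X FX Xa] [Y FY Yb].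
    have [XY|YX] := Ftot X Y FX FY.
    + by exists Y => //; apply: (proj1 (FS _ FY)) => //; apply: XY.
    + by exists X => //; apply: (proj1 (FS _ FX)) => //; apply: YX.
  - by move=> [X FX X1]; apply: (proj2 (FS _ FX)).
exists C; split => // a a1.
have [Ca|nCa] := pselect (C a); first by left.
have [Ca|nCa'] := pselect (C a^-1); first by right.
have [k Ck] := maximal_cone_has Ccone Cmax nCa a1.
have a1' : a^-1 <> 1 by move=> /(congr1 (@monoid.inv P)); rewrite invgK invg1.
have [l Cl] := maximal_cone_has Ccone Cmax nCa' a1'.
rewrite invgK in Cl.
case: (proj2 Ccone).
have := proj1 Ccone _ _ (cone_expg l Ccone Ck) (cone_expg k Ccone Cl).
by rewrite -!expgnA expVgn (mulnC l.+1) mulVg.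
Qed.

End SemifieldOrder.

(* monalg only makes [malg] a ring over monoids without nontrivial units, so
   the convolution product is defined here. *)
Definition group_ring (P : semifieldType) := monalg.malg P int.
HB.instance Definition _ P := GRing.Zmodule.on (group_ring P).

Section GroupRing.
Variable P : semifieldType.
Implicit Types (f g h : group_ring P) (a b c : P).

Definition gr_monom a (c : int) : group_ring P := monalg.mkmalgU a c.
Local Notation supp := (@monalg.msupp P int).
Local Notation coef := (@monalg.mcoeff P int).

Definition gr_mul f g : group_ring P :=
  \sum_(a <- supp f) \sum_(b <- supp g) gr_monom (a * b)%g (coef a f * coef b g).

Lemma gr_monom0 a : gr_monom a 0 = 0. Proof. exact: monalg.monalgU0. Qed.

Lemma gr_monomD a : {morph gr_monom a : x y / x + y}.
Proof. exact: monalg.monalgUD. Qed.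

Lemma gr_mulw (d1 d2 : {fset P}) f g :
  fsubset (supp f) d1 -> fsubset (supp g) d2 ->
  gr_mul f g =
    \sum_(a <- d1) \sum_(b <- d2) gr_monom (a * b)%g (coef a f * coef b g).
Proof.
move=> s1 s2; rewrite /gr_mul (big_fset_incl _ s1) /=.
  apply/eq_bigr=> a _; apply/big_fset_incl => // b _ /monalg.mcoeff_outdom ->.
  by rewrite mulr0 gr_monom0.
move=> a _ /monalg.mcoeff_outdom fa.
by rewrite big1 // => b _; rewrite fa mul0r gr_monom0.
Qed.

Lemma gr_mulC : commutative gr_mul.
Proof.
move=> f g; rewrite /gr_mul exchange_big; apply: eq_bigr => b _.
by apply: eq_bigr => a _; rewrite smulC mulrC.
Qed.

Lemma gr_mulDl : left_distributive gr_mul +%R.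
Proof.
move=> f g h.
pose d := fsetU (supp f) (supp g).
have sf : fsubset (supp f) d by apply: fsubsetUl.
have sg : fsubset (supp g) d by apply: fsubsetUr.
have sfg : fsubset (supp (f + g)) d by apply: monalg.msuppD_le.
rewrite !(@gr_mulw d (supp h)) // -big_split /=; apply: eq_bigr => a _.
rewrite -big_split /=; apply: eq_bigr => b _.
by rewrite monalg.mcoeffD mulrDl gr_monomD.
Qed.

Lemma gr_mul0r : left_zero 0 gr_mul.
Proof. by move=> f; rewrite /gr_mul monalg.msupp0 big_seq_fset0. Qed.

Lemma gr_mulUU a b x y :
  gr_mul (gr_monom a x) (gr_monom b y) = gr_monom (a * b)%g (x * y).
Proof.
rewrite (gr_mulw monalg.msuppU_le monalg.msuppU_le) !big_seq_fset1.
by rewrite !monalg.mcoeffUU.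
Qed.

Lemma gr_expand f : f = \sum_(a <- supp f) gr_monom a (coef a f).
Proof. exact: monalg.monalgE. Qed.

Lemma gr_mulsl (I : Type) (r : seq I) (F : I -> group_ring P) g :
  gr_mul (\sum_(i <- r) F i) g = \sum_(i <- r) gr_mul (F i) g.
Proof.
exact: (big_morph (gr_mul^~ g) (fun _ _ => gr_mulDl _ _ _) (gr_mul0r _)).
Qed.

Lemma gr_mulsr (I : Type) (r : seq I) (F : I -> group_ring P) g :
  gr_mul g (\sum_(i <- r) F i) = \sum_(i <- r) gr_mul g (F i).
Proof. by rewrite gr_mulC gr_mulsl; apply: eq_bigr => i _; rewrite gr_mulC. Qed.

Lemma gr_mulA : associative gr_mul.
Proof.
have mm a x b y h : gr_mul (gr_monom a x) (gr_mul (gr_monom b y) h) =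
    gr_mul (gr_mul (gr_monom a x) (gr_monom b y)) h.
  rewrite (gr_expand h) !gr_mulsr; apply: eq_bigr => c _.
  by rewrite !gr_mulUU mulrA mulgA.
have m a x g h : gr_mul (gr_monom a x) (gr_mul g h) =
    gr_mul (gr_mul (gr_monom a x) g) h.
  rewrite (gr_expand g) gr_mulsl !gr_mulsr gr_mulsl.
  by apply: eq_bigr => b _; apply: mm.
move=> f g h; rewrite (gr_expand f) !gr_mulsl.
by apply: eq_bigr => a _; apply: m.
Qed.

Lemma gr_mul1r : left_id (gr_monom 1%g 1) gr_mul.
Proof.
move=> f; rewrite (gr_expand f) gr_mulsr; apply: eq_bigr => a _.
by rewrite gr_mulUU mul1g mul1r.
Qed.

Lemma gr_oner_neq0 : gr_monom 1%g 1 != 0.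
Proof. by apply/eqP => /(congr1 (coef 1%g)); rewrite monalg.mcoeffUU raddf0. Qed.

HB.instance Definition _ := GRing.Zmodule_isComNzRing.Build (group_ring P)
  gr_mulA gr_mulC gr_mul1r gr_mulDl gr_oner_neq0.

Lemma seq_max (C : set P) : strict_cone C ->
  (forall a, a <> 1%g -> C a \/ C (a^-1)%g) ->
  forall s : seq P, s != [::] ->
  exists2 a, a \in s & forall b, b \in s -> b <> a -> C (a * b^-1)%g.
Proof.
move=> [CM _] Ctot; elim=> [//|x s IH] _.
have [->|/IH[a sa amax]] := eqVneq s [::].
  by exists x; rewrite ?mem_head // => b; rewrite inE => /eqP ->.
have [->|xa] := eqVneq x a.
  exists a; first exact: mem_head.
  by move=> b; rewrite inE => /orP[/eqP->//|]; apply: amax.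
have ne : (a * x^-1)%g <> 1%g.
  by move=> e; move/eqP: xa; apply; rewrite -[LHS]mul1g -e mulgVK.
have [Ca|Cx] := Ctot _ ne.
  exists a; first by rewrite inE sa orbT.
  by move=> b; rewrite inE => /orP[/eqP->//|]; apply: amax.
exists x; first exact: mem_head.
rewrite invgM invgK in Cx.
move=> b; rewrite inE => /orP[/eqP->//|sb _].
have [->//|/eqP ba] := eqVneq b a.
by have := CM _ _ Cx (amax b sb ba); rewrite mulgA mulgVK.
Qed.

Lemma gr_mulf_eq0 f g : f * g = 0 -> (f == 0) || (g == 0).
Proof.
move=> fg0; apply/negPn/negP; rewrite negb_or => /andP[f0 g0].
have suppN0 h : h != 0 -> (supp h : seq P) != [::].
  by apply: contraNneq => e; rewrite (gr_expand h) e big_nil.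
have [C [Ccone Ctot]] := total_cone P.
have [a fa amax] := seq_max Ccone Ctot (suppN0 _ f0).
have [b gb bmax] := seq_max Ccone Ctot (suppN0 _ g0).
have [CM C1] := Ccone.
have neq a' b' : a' \in supp f -> b' \in supp g -> (a' != a) || (b' != b) ->
    (a' * b' == a * b)%g = false.
  move=> fa' gb' ne; apply/negP => /eqP e; apply: C1.
  have e1 : ((a * a'^-1) * (b * b'^-1) = 1)%g.
    have -> : (a * a'^-1 * (b * b'^-1) = a * b * (a'^-1 * b'^-1))%g.
      by rewrite -!mulgA; congr (_ * _)%g; rewrite !mulgA (smulC (a'^-1)%g).
    by rewrite -invgM (smulC b') e mulgV.
  have [ea|/eqP na] := eqVneq a' a.
    have nb : b' <> b by apply/eqP; move: ne; rewrite ea eqxx.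
    by move: e1; rewrite ea mulgV mul1g => <-; apply: bmax.
  have [eb|/eqP nb] := eqVneq b' b.
    by move: e1; rewrite eb mulgV mulg1 => <-; apply: amax.
  by rewrite -e1; apply: CM; [apply: amax|apply: bmax].
have : coef (a * b)%g (f * g) = coef a f * coef b g.
  rewrite /GRing.mul /= /gr_mul raddf_sum /= (big_fsetD1 a) //= raddf_sum /=.
  rewrite (big_fsetD1 b) //= monalg.mcoeffUU !big1_fset ?addr0 //.
  - move=> a'; rewrite in_fsetD1 => /andP[na fa'] _.
    rewrite raddf_sum big1_fset // => b' gb' _.
    by rewrite /gr_monom /= monalg.mcoeffU neq // na.
  - move=> b'; rewrite in_fsetD1 => /andP[nb gb'] _.
    by rewrite /gr_monom monalg.mcoeffU neq // nb orbT.
rewrite fg0 raddf0 => /esym /eqP; rewrite mulf_eq0.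
by rewrite !monalg.mcoeff_eq0 fa gb.
Qed.

Definition gr_unit f : bool := `[< exists g, g * f = 1 >].

Definition gr_inv f : group_ring P :=
  if pselect (exists g, g * f = 1) is left ex then projT1 (cid ex) else f.

Fact gr_mulVr : {in gr_unit, left_inverse 1 gr_inv *%R}.
Proof.
move=> f /asboolP fu; rewrite /gr_inv; case: pselect => // ex.
exact: (projT2 (cid ex)).
Qed.

Fact gr_unitP f g : g * f = 1 -> gr_unit f.
Proof. by move=> e; apply/asboolP; exists g. Qed.

Fact gr_inv_out : {in [predC gr_unit], gr_inv =1 id}.
Proof. by move=> f /asboolP fu; rewrite /gr_inv; case: pselect. Qed.

HB.instance Definition _ := GRing.ComNzRing_hasMulInverse.Build (group_ring P)
  gr_mulVr gr_unitP gr_inv_out.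
HB.instance Definition _ :=
  GRing.ComUnitRing_isIntegral.Build (group_ring P) gr_mulf_eq0.

End GroupRing.

Section PositiveReals.
Variable R : realType.

Record posreal := PosReal { posreal_val :> R; posreal_gt0 : 0 < posreal_val }.

HB.instance Definition _ := [isSub for posreal_val].
HB.instance Definition _ := [Choice of posreal by <:].

Implicit Types a b c : posreal.

Definition posreal_mul a b :=
  PosReal (mulr_gt0 (posreal_gt0 a) (posreal_gt0 b)).
Definition posreal_add a b :=
  PosReal (addr_gt0 (posreal_gt0 a) (posreal_gt0 b)).
Definition posreal_one := PosReal (@ltr01 R).
Fact posreal_inv_subproof a : 0 < (a : R)^-1.
Proof. by rewrite invr_gt0 posreal_gt0. Qed.
Definition posreal_inv a := PosReal (posreal_inv_subproof a).

Fact posreal_mulA : associative posreal_mul.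
Proof. by move=> a b c; apply: val_inj; rewrite /= mulrA. Qed.
Fact posreal_mul1 : left_id posreal_one posreal_mul.
Proof. by move=> a; apply: val_inj; rewrite /= mul1r. Qed.
Fact posreal_mulC : commutative posreal_mul.
Proof. by move=> a b; apply: val_inj; rewrite /= mulrC. Qed.
Fact posreal_mulr1 : right_id posreal_one posreal_mul.
Proof. by move=> a; apply: val_inj; rewrite /= mulr1. Qed.
Fact posreal_mulV : left_inverse posreal_one posreal_inv posreal_mul.
Proof.
by move=> a; apply: val_inj; rewrite /= mulVf // gt_eqF ?posreal_gt0.
Qed.
Fact posreal_mulrV : right_inverse posreal_one posreal_inv posreal_mul.
Proof. by move=> a; rewrite posreal_mulC posreal_mulV. Qed.

HB.instance Definition _ := isGroup.Build posreal
  posreal_mulA posreal_mul1 posreal_mulr1 posreal_mulV posreal_mulrV.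

Fact posreal_addA : associative posreal_add.
Proof. by move=> a b c; apply: val_inj; rewrite /= addrA. Qed.
Fact posreal_addC : commutative posreal_add.
Proof. by move=> a b; apply: val_inj; rewrite /= addrC. Qed.
Fact posreal_mulDr : right_distributive posreal_mul posreal_add.
Proof. by move=> a b c; apply: val_inj; rewrite /= mulrDr. Qed.

HB.instance Definition _ := Group_isSemifield.Build posreal
  posreal_mulC posreal_addA posreal_addC posreal_mulDr.

End PositiveReals.

Section TropicalSemifield.
Variable V : finType.

(* The Laurent monomial \prod_v v^(e v), given by its exponents e. *)
Record trop := Trop { trop_exp : {ffun V -> int} }.

HB.instance Definition _ := [isNew for trop_exp].
HB.instance Definition _ := [Choice of trop by <:].

Implicit Types a b c : trop.

Definition trop_mul a b := Trop [ffun v => trop_exp a v + trop_exp b v].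
Definition trop_min a b :=
  Trop [ffun v => Num.min (trop_exp a v) (trop_exp b v)].
Definition trop_one := Trop [ffun=> 0].
Definition trop_inv a := Trop [ffun v => - trop_exp a v].
Definition trop_var (v : V) := Trop [ffun u => (u == v)%:R].

Fact trop_mulA : associative trop_mul.
Proof. by move=> a b c; apply/val_inj/ffunP => v; rewrite !ffunE addrA. Qed.
Fact trop_mulC : commutative trop_mul.
Proof. by move=> a b; apply/val_inj/ffunP => v; rewrite !ffunE addrC. Qed.
Fact trop_mul1 : left_id trop_one trop_mul.
Proof. by move=> a; apply/val_inj/ffunP => v; rewrite !ffunE add0r. Qed.
Fact trop_mulr1 : right_id trop_one trop_mul.
Proof. by move=> a; rewrite trop_mulC trop_mul1. Qed.
Fact trop_mulV : left_inverse trop_one trop_inv trop_mul.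
Proof. by move=> a; apply/val_inj/ffunP => v; rewrite !ffunE addNr. Qed.
Fact trop_mulrV : right_inverse trop_one trop_inv trop_mul.
Proof. by move=> a; rewrite trop_mulC trop_mulV. Qed.

HB.instance Definition _ := isGroup.Build trop
  trop_mulA trop_mul1 trop_mulr1 trop_mulV trop_mulrV.

Fact trop_minA : associative trop_min.
Proof. by move=> a b c; apply/val_inj/ffunP => v; rewrite !ffunE minA. Qed.
Fact trop_minC : commutative trop_min.
Proof. by move=> a b; apply/val_inj/ffunP => v; rewrite !ffunE minC. Qed.
Fact trop_mulDr : right_distributive trop_mul trop_min.
Proof. by move=> a b c; apply/val_inj/ffunP => v; rewrite !ffunE addr_minr. Qed.

HB.instance Definition _ := Group_isSemifield.Build trop
  trop_mulC trop_minA trop_minC trop_mulDr.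

End TropicalSemifield.

Section SubtractionFree.
Variable V : finType.

Definition zpoly := mpoly.mpoly #|V| int.
HB.instance Definition _ := GRing.IntegralDomain.on zpoly.

Definition zpoly_var (v : V) : zpoly :=
  mpoly.mpolyX int (mpoly.mnm1 (enum_rank v)).

Definition nonneg_coef (p : zpoly) : Prop := forall m, 0 <= mpoly.mcoeff m p.

Definition sf_quot (f : {fraction zpoly}) (p q : zpoly) : Prop :=
  [/\ p != 0, q != 0, nonneg_coef p, nonneg_coef q &
      f = FracField.tofrac p / FracField.tofrac q].

Definition subtraction_free (f : {fraction zpoly}) : bool :=
  `[< exists p q, sf_quot f p q >].

Record Qplus := QPlus {
  Qplus_val : {fraction zpoly};
  Qplus_sf : subtraction_free Qplus_val }.

HB.instance Definition _ := [isSub for Qplus_val].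
HB.instance Definition _ := [Choice of Qplus by <:].

Lemma nonneg_coefM p q : nonneg_coef p -> nonneg_coef q -> nonneg_coef (p * q).
Proof.
by move=> pp pq m; rewrite mpoly.mcoeffM sumr_ge0 // => k _; apply: mulr_ge0.
Qed.

Lemma nonneg_coefD p q : nonneg_coef p -> nonneg_coef q -> nonneg_coef (p + q).
Proof. by move=> pp pq m; rewrite mpoly.mcoeffD addr_ge0. Qed.

Lemma nonneg_coefX m c : 0 <= c -> nonneg_coef (c *: mpoly.mpolyX int m).
Proof.
by move=> c0 k; rewrite mpoly.mcoeffZ mpoly.mcoeffX mulr_ge0.
Qed.

Lemma nonneg_coefP p m : nonneg_coef p -> 0 <= mpoly.mcoeff m p.
Proof. exact. Qed.

Lemma nonneg_coefD_neq0 p q : p != 0 -> nonneg_coef p -> nonneg_coef q ->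
  p + q != 0.
Proof.
move=> p0 pp qq; apply: contraNneq p0 => e; apply/eqP/mpoly.mpolyP => m.
have := congr1 (mpoly.mcoeff m) e; rewrite mpoly.mcoeffD mpoly.mcoeff0.
have := nonneg_coefP m pp; have := nonneg_coefP m qq; lia.
Qed.

Lemma sf_quotM f g p q p' q' :
  sf_quot f p q -> sf_quot g p' q' -> sf_quot (f * g) (p * p') (q * q').
Proof.
move=> [p0 q0 pp pq ->] [p0' q0' pp' pq' ->].
split; rewrite ?mulf_neq0 //; try exact: nonneg_coefM.
by rewrite !tofracM invfM mulrACA.
Qed.

Lemma sf_quotV f p q : sf_quot f p q -> sf_quot f^-1 q p.
Proof. by move=> [p0 q0 pp pq ->]; split; rewrite // invfM invrK mulrC. Qed.

Lemma sf_quotD f g p q p' q' : sf_quot f p q -> sf_quot g p' q' ->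
  sf_quot (f + g) (p * q' + p' * q) (q * q').
Proof.
move=> [p0 q0 pp pq ->] [p0' q0' pp' pq' ->]; split.
- by apply: nonneg_coefD_neq0; rewrite ?mulf_neq0 //; apply: nonneg_coefM.
- by rewrite mulf_neq0.
- by apply: nonneg_coefD; apply: nonneg_coefM.
- exact: nonneg_coefM.
by rewrite tofracD !tofracM addf_div ?tofrac_eq0.
Qed.

Lemma sf_quot1 : sf_quot 1 1 1.
Proof.
have p1 : nonneg_coef 1 by move=> m; rewrite mpoly.mcoeff1.
by split; rewrite ?oner_neq0 ?tofrac1 ?divr1.
Qed.

Lemma sf_quot_var v : sf_quot (FracField.tofrac (zpoly_var v)) (zpoly_var v) 1.
Proof.
have [_ n10 _ p1 _] := sf_quot1.
split=> //; last by rewrite tofrac1 divr1.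
  apply/eqP => /(congr1 (mpoly.mcoeff (mpoly.mnm1 (enum_rank v)))).
  by rewrite mpoly.mcoeffXU eqxx mpoly.mcoeff0.
by move=> m; rewrite mpoly.mcoeffX.
Qed.

Implicit Types a b c : Qplus.

Fact Qplus_mul_subproof a b : subtraction_free (Qplus_val a * Qplus_val b).
Proof.
have /asboolP[p [q h]] := Qplus_sf a; have /asboolP[p' [q' h']] := Qplus_sf b.
by apply/asboolP; do 2!eexists; apply: sf_quotM h h'.
Qed.
Fact Qplus_add_subproof a b : subtraction_free (Qplus_val a + Qplus_val b).
Proof.
have /asboolP[p [q h]] := Qplus_sf a; have /asboolP[p' [q' h']] := Qplus_sf b.
by apply/asboolP; do 2!eexists; apply: sf_quotD h h'.
Qed.
Fact Qplus_inv_subproof a : subtraction_free (Qplus_val a)^-1.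
Proof.
have /asboolP[p [q h]] := Qplus_sf a.
by apply/asboolP; do 2!eexists; apply: sf_quotV h.
Qed.
Fact Qplus_one_subproof : subtraction_free 1.
Proof. by apply/asboolP; do 2!eexists; apply: sf_quot1. Qed.
Fact Qplus_var_subproof v : subtraction_free (FracField.tofrac (zpoly_var v)).
Proof. by apply/asboolP; do 2!eexists; apply: sf_quot_var. Qed.

Definition Qplus_mul a b := QPlus (Qplus_mul_subproof a b).
Definition Qplus_add a b := QPlus (Qplus_add_subproof a b).
Definition Qplus_inv a := QPlus (Qplus_inv_subproof a).
Definition Qplus_one := QPlus Qplus_one_subproof.
Definition Qplus_var v := QPlus (Qplus_var_subproof v).

Lemma Qplus_neq0 a : Qplus_val a != 0.
Proof.
have /asboolP[p [q [p0 q0 _ _ ->]]] := Qplus_sf a.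
by rewrite mulf_neq0 ?invr_neq0 ?tofrac_eq0.
Qed.

Fact Qplus_mulA : associative Qplus_mul.
Proof. by move=> a b c; apply: val_inj; rewrite /= mulrA. Qed.
Fact Qplus_mulC : commutative Qplus_mul.
Proof. by move=> a b; apply: val_inj; rewrite /= mulrC. Qed.
Fact Qplus_mul1 : left_id Qplus_one Qplus_mul.
Proof. by move=> a; apply: val_inj; rewrite /= mul1r. Qed.
Fact Qplus_mulr1 : right_id Qplus_one Qplus_mul.
Proof. by move=> a; rewrite Qplus_mulC Qplus_mul1. Qed.
Fact Qplus_mulV : left_inverse Qplus_one Qplus_inv Qplus_mul.
Proof. by move=> a; apply: val_inj; rewrite /= mulVf ?Qplus_neq0. Qed.
Fact Qplus_mulrV : right_inverse Qplus_one Qplus_inv Qplus_mul.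
Proof. by move=> a; rewrite Qplus_mulC Qplus_mulV. Qed.

HB.instance Definition _ := isGroup.Build Qplus
  Qplus_mulA Qplus_mul1 Qplus_mulr1 Qplus_mulV Qplus_mulrV.

Fact Qplus_addA : associative Qplus_add.
Proof. by move=> a b c; apply: val_inj; rewrite /= addrA. Qed.
Fact Qplus_addC : commutative Qplus_add.
Proof. by move=> a b; apply: val_inj; rewrite /= addrC. Qed.
Fact Qplus_mulDr : right_distributive Qplus_mul Qplus_add.
Proof. by move=> a b c; apply: val_inj; rewrite /= mulrDr. Qed.

HB.instance Definition _ := Group_isSemifield.Build Qplus
  Qplus_mulC Qplus_addA Qplus_addC Qplus_mulDr.

Definition is_tropicalization (pi : Qplus -> trop V) : Prop :=
  semifield_hom pi /\ forall v, pi (Qplus_var v) = trop_var v.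

Definition zpoly_exp (v : V) (m : mpoly.multinom #|V|) : nat := m (enum_rank v).

Definition is_mindeg (v : V) (p : zpoly) (e : nat) : Prop :=
  (exists2 m, m \in mpoly.msupp p & zpoly_exp v m = e) /\
  forall m, m \in mpoly.msupp p -> (e <= zpoly_exp v m)%N.

Lemma is_mindeg_uniq v p e e' : is_mindeg v p e -> is_mindeg v p e' -> e = e'.
Proof.
by move=> [[m pm <-] lm] [[m' pm' <-] lm']; apply/eqP; rewrite eqn_leq lm // lm'.
Qed.

Lemma is_mindeg_exists v p : p != 0 -> exists e, is_mindeg v p e.
Proof.
rewrite -mpoly.msupp_eq0 => p0.
pose Q e := has (fun m => zpoly_exp v m == e) (mpoly.msupp p).
have exQ : exists e, Q e.
  case: (mpoly.msupp p) p0 @Q => [//|m s] _ Q.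
  by exists (zpoly_exp v m); rewrite /Q /= eqxx.
case: (ex_minnP exQ) => e /hasP[m pm /eqP me] le; exists e; split; first by exists m.
by move=> m' pm'; apply: le; apply/hasP; exists m'.
Qed.

Lemma nonneg_msupp p m : nonneg_coef p ->
  (m \in mpoly.msupp p) = (0 < mpoly.mcoeff m p).
Proof. by move=> pp; rewrite mpoly.mcoeff_msupp lt0r nonneg_coefP // andbT. Qed.

Lemma nonneg_split p m : nonneg_coef p ->
  exists2 p', nonneg_coef p' & p = mpoly.mcoeff m p *: mpoly.mpolyX int m + p'.
Proof.
move=> pp; exists (p - mpoly.mcoeff m p *: mpoly.mpolyX int m); last by rewrite addrC subrK.
move=> k; rewrite mpoly.mcoeffB mpoly.mcoeffZ mpoly.mcoeffX.
case: eqP => [<-|_]; first by rewrite mulr1 subrr.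
by rewrite mulr0 subr0; apply: nonneg_coefP.
Qed.

Lemma is_mindegM v p q e e' : nonneg_coef p -> nonneg_coef q ->
  is_mindeg v p e -> is_mindeg v q e' -> is_mindeg v (p * q) (e + e').
Proof.
move=> pp pq [[m pm me] lm] [[m' pm' me'] lm']; split; last first.
  move=> k /mpoly.msuppM_le /allpairsP[[k1 k2] [/= h1 h2 ->]].
  by rewrite /zpoly_exp mpoly.mnmDE leq_add ?lm ?lm'.
exists (mpoly.mnm_add m m'); last by rewrite /zpoly_exp mpoly.mnmDE -me -me'.
rewrite nonneg_msupp; last exact: nonneg_coefM.
have [p1 pp1 ep] := nonneg_split m pp; have [q1 pq1 eq] := nonneg_split m' pq.
have cm : 0 < mpoly.mcoeff m p by rewrite -nonneg_msupp.
have cm' : 0 < mpoly.mcoeff m' q by rewrite -nonneg_msupp.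
rewrite ep eq mulrDl (mulrDr (_ *: _)) -!addrA.
rewrite mpoly.mcoeffD ltr_pwDl //.
  rewrite -scalerAl -scalerAr scalerA -mpoly.mpolyXD mpoly.mcoeffZ mpoly.mcoeffX.
  by rewrite eqxx mulr1 mulr_gt0.
have nm := nonneg_coefX m (ltW cm); have nm' := nonneg_coefX m' (ltW cm').
apply: (nonneg_coefD (nonneg_coefM nm pq1)).
by apply: (nonneg_coefM pp1); apply: nonneg_coefD.
Qed.

Lemma is_mindegD v p q e e' : nonneg_coef p -> nonneg_coef q ->
  is_mindeg v p e -> is_mindeg v q e' -> is_mindeg v (p + q) (minn e e').
Proof.
move=> pp pq [[m pm me] lm] [[m' pm' me'] lm'].
have supp k : (k \in mpoly.msupp (p + q)) =
    (k \in mpoly.msupp p) || (k \in mpoly.msupp q).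
  rewrite !nonneg_msupp //; last exact: nonneg_coefD.
  rewrite mpoly.mcoeffD.
  have := nonneg_coefP k pp; have := nonneg_coefP k pq; lia.
split; last first.
  by move=> k; rewrite supp geq_min => /orP[/lm ->//|/lm' ->]; rewrite orbT.
case: (leqP e e') => ee; first by exists m; rewrite ?supp ?pm.
by exists m'; rewrite ?supp ?pm' ?orbT.
Qed.

(* An exponent of pi (p / q) is the difference of the least exponents in p and
   in q. *)
Lemma tropicalization_exists : exists pi, is_tropicalization pi.
Proof.
have h (a : Qplus) : exists t : trop V, forall p q v e e',
    sf_quot (Qplus_val a) p q -> is_mindeg v p e -> is_mindeg v q e' ->
    trop_exp t v = e%:Z - e'%:Z.
  have /asboolP[p [q hpq]] := Qplus_sf a; have [p0 q0 pp pq ea] := hpq.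
  pose deg r (r0 : r != 0) v := sval (cid (is_mindeg_exists v r0)).
  have degP r r0 v : is_mindeg v r (deg r r0 v) by apply: svalP.
  exists (Trop [ffun v => (deg p p0 v)%:Z - (deg q q0 v)%:Z]).
  move=> p' q' v e e' [p0' q0' pp' pq' ea'] he he'; rewrite ffunE.
  have epq : p * q' = p' * q.
    apply/eqP; rewrite -tofrac_eq !tofracM -eqr_div ?tofrac_eq0 //.
    by rewrite -ea ea'.
  have h1 := is_mindegM pp pq' (degP p p0 v) he'.
  have := is_mindegM pp' pq he (degP q q0 v).
  by rewrite -epq => /(is_mindeg_uniq h1); lia.
pose pi a := sval (cid (h a)).
have piP a p q v e e' : sf_quot (Qplus_val a) p q -> is_mindeg v p e ->
    is_mindeg v q e' -> trop_exp (pi a) v = e%:Z - e'%:Z.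
  exact: (svalP (cid (h a))).
exists pi; split; first split.
- move=> a b; apply/val_inj/ffunP => v; rewrite ffunE /=.
  have /asboolP[p [q hp]] := Qplus_sf a; have /asboolP[p' [q' hp']] := Qplus_sf b.
  have [p0 q0 pp pq _] := hp; have [p0' q0' pp' pq' _] := hp'.
  have [[e he] [e' he']] := (is_mindeg_exists v p0, is_mindeg_exists v q0).
  have [[k hk] [k' hk']] := (is_mindeg_exists v p0', is_mindeg_exists v q0').
  rewrite (piP _ _ _ _ _ _ hp he he') (piP _ _ _ _ _ _ hp' hk hk').
  rewrite (piP (a * b)%g _ _ _ _ _ (sf_quotM hp hp')
    (is_mindegM pp pp' he hk) (is_mindegM pq pq' he' hk')).
  lia.
- move=> a b; apply/val_inj/ffunP => v; rewrite ffunE /=.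
  have /asboolP[p [q hp]] := Qplus_sf a; have /asboolP[p' [q' hp']] := Qplus_sf b.
  have [p0 q0 pp pq _] := hp; have [p0' q0' pp' pq' _] := hp'.
  have [[e he] [e' he']] := (is_mindeg_exists v p0, is_mindeg_exists v q0).
  have [[k hk] [k' hk']] := (is_mindeg_exists v p0', is_mindeg_exists v q0').
  rewrite (piP _ _ _ _ _ _ hp he he') (piP _ _ _ _ _ _ hp' hk hk').
  have hn := is_mindegD (nonneg_coefM pp pq') (nonneg_coefM pp' pq)
    (is_mindegM pp pq' he hk') (is_mindegM pp' pq hk he').
  rewrite (piP (a \oplus b) _ _ _ _ _ (sf_quotD hp hp') hn
    (is_mindegM pq pq' he' hk')).
  lia.
move=> v; apply/val_inj/ffunP => u; rewrite ffunE /=.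
rewrite (piP (Qplus_var v) _ _ _ (u == v) 0%N (sf_quot_var v)).
- by rewrite subr0; case: eqP.
- split=> [|m]; rewrite mpoly.msuppX.
    exists (mpoly.mnm1 (enum_rank v)); first exact: mem_head.
    by rewrite /zpoly_exp mpoly.mnm1E (inj_eq enum_rank_inj) eq_sym.
  by rewrite inE => /eqP ->; rewrite /zpoly_exp mpoly.mnm1E (inj_eq enum_rank_inj) eq_sym.
split=> // ; exists mpoly.mnm0; last by rewrite /zpoly_exp mpoly.mnm0E.
by rewrite mpoly.msupp1 mem_head.
Qed.

End SubtractionFree.

(* [inl i] is y_i and [inr (i; s)], for 0 < s < d_i, is z_{i,s}. *)
Notation inner_index d := (fun i => {s : 'I_(d i).+1 | (0 < s < d i)%N}).

Definition yzvar (n : nat) (d : 'I_n -> nat) : finType :=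
  ('I_n + {i : 'I_n & inner_index d i})%type.

Definition Qyz (n : nat) (d : 'I_n -> nat) : semifieldType := Qplus (yzvar d).

Definition ygen (n : nat) (d : 'I_n -> nat) (i : 'I_n) : Qyz d :=
  Qplus_var (inl i : yzvar d).

Definition zgen (n : nat) (d : 'I_n -> nat) (i : 'I_n) (s : 'I_(d i).+1) :
    Qyz d :=
  if insub s is Some u
  then Qplus_var (inr (Tagged (inner_index d) u) : yzvar d) else 1%g.

Definition cvector (n : nat) (d : 'I_n -> nat) (pi : Qyz d -> trop (yzvar d))
    (a : Qyz d) (j : 'I_n) : int :=
  trop_exp (pi a) (inl j).

(* By sign coherence, the second case is that of a nonzero c-vector with
   nonpositive components when [a] is a coefficient y_i[t]. *)
Definition tropical_sign (n : nat) (d : 'I_n -> nat)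
    (pi : Qyz d -> trop (yzvar d)) (a : Qyz d) : int :=
  if [forall j, 0 <= cvector pi a j] then 1 else -1.

Section Seeds.
Variables (n : nat) (d : 'I_n -> nat) (P : semifieldType).

Definition QP := {fraction (group_ring P)}.
HB.instance Definition _ := GRing.Field.on QP.

(* The field Q(P)(w_1, ..., w_n). *)
Definition ambient := {fraction (mpoly.mpoly n QP)}.
HB.instance Definition _ := GRing.Field.on ambient.

Definition QP_ambient (c : QP) : ambient :=
  FracField.tofrac (mpoly.mpolyC n c).

Definition P_ambient (a : P) : ambient :=
  QP_ambient (FracField.tofrac (gr_monom a 1)).

Definition algebraically_independent (x : 'I_n -> ambient) : Prop :=
  forall p : mpoly.mpoly n QP, mpoly.mmap QP_ambient x p = 0 -> p = 0.

Record seed := Seed {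
  seed_B : 'M[int]_n;
  seed_x : 'I_n -> ambient;
  seed_y : 'I_n -> P;
  seed_z : forall i : 'I_n, 'I_(d i).+1 -> P }.

Arguments seed_z : clear implicits.

Definition skew_symmetrizer (r : 'I_n -> nat) (B : 'M[int]_n) : Prop :=
  (forall i, 0 < r i)%N /\
  let RB := diag_mx (\row_i (r i)%:Z) *m B in RB^T = - RB.

Definition is_seed (S : seed) : Prop :=
  [/\ exists r, skew_symmetrizer r (seed_B S),
      algebraically_independent (seed_x S) &
      forall i, seed_z S i ord0 = 1%g /\ seed_z S i ord_max = 1%g].

Definition pos_part (a : int) : int := Num.max a 0.

Section Mutation.
Variables (k : 'I_n) (S : seed).
Let B := seed_B S.
Let x := seed_x S.
Let y := seed_y S.
Let z := seed_z S.
Arguments z : clear implicits.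

Definition yhat (i : 'I_n) : ambient :=
  P_ambient (y i) * \prod_j x j ^ B j i.

Definition P_yhat : ambient := \sum_s P_ambient (z k s) * yhat k ^+ s.

Definition P_y : P := oplus_sum (fun s => z k s * y k ^+ s)%g.

Definition mutate_B : 'M[int]_n :=
  \matrix_(i, j)
    if (i == k) || (j == k) then - B i j
    else B i j + (d k)%:Z * (pos_part (- B i k) * B k j
                             + B i k * pos_part (B k j)).

Definition mutate_x (i : 'I_n) : ambient :=
  if i == k then
    (x k)^-1 * (\prod_j x j ^ pos_part (- B j k)) ^+ d k
      * (P_yhat / P_ambient P_y)
  else x i.

Definition mutate_y (i : 'I_n) : P :=
  if i == k then ((y k)^-1)%g
  else (y i * gexpz (y k) (pos_part (B k i)) ^+ d k * gexpz P_y (- B k i))%g.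

Definition mutate_z (i : 'I_n) (s : 'I_(d i).+1) : P :=
  if i == k then z i (rev_ord s) else z i s.

Definition mutate : seed := Seed mutate_B mutate_x mutate_y mutate_z.

End Mutation.

Definition sigma_periodic (sigma : 'S_n) (S S' : seed) : Prop :=
  [/\ forall i j, seed_B S' (sigma i) (sigma j) = seed_B S i j,
      forall i, seed_x S' (sigma i) = seed_x S i &
      forall i, seed_y S' (sigma i) = seed_y S i].

End Seeds.

Arguments seed_z {n d P} S i s : rename.

Section Dilogarithm.
Variables (R : realType) (delta : nat).
Implicit Types zeta : 'I_delta.+1 -> R.

Definition dilog_poly zeta : {poly R} := \sum_s zeta s *: 'X^s.

Definition generic_condition zeta : Prop :=
  forall x : R, root (dilog_poly zeta) x -> x = -1.

(* As ln 0 = 0 and _ / 0 = 0 the integrand is total; its value at y = 0 is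
   irrelevant to the Lebesgue integral. *)
Definition dilog zeta (x : R) : R :=
  let P := dilog_poly zeta in
  2^-1 * \int[lebesgue_measure]_(y in `[0, x])
    (ln P.[y] / y - ln y / P.[y] * (P^`()).[y]).

Definition dilog_infty zeta : R := lim (dilog zeta x @[x --> +oo])%classic.

End Dilogarithm.

Definition reverse (T : Type) (delta : nat) (zeta : 'I_delta.+1 -> T)
    (s : 'I_delta.+1) : T :=
  zeta (rev_ord s).

(* Main.v *)
(** Since [P_{zeta*}(1/x) = x^-delta P_zeta(x)], the dilogarithm integrands f
    satisfy [f_{zeta*}(1/x) / x = x f_zeta(x)].  Hence
    [t |-> L_zeta(e^t) + L_{zeta*}(e^-t)] has derivative 0, and letting t tend
    to infinity gives the reflection formula
    [L_zeta(x) + L_{zeta*}(1/x) = L_zeta(oo)].  The tuples [z_k[t]] keep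
    endpoints 1 under mutation, so this formula at [x = phi(y_{k_t}[t])]
    shows, when the tropical sign is -1, that the t-th term of the left side
    of the first identity minus that of its right side is the t-th term of the
    second identity; when the sign is 1 this is trivial. *)

Require Import Defs.
From mathcomp Require Import all_boot all_order all_algebra perm.
From mathcomp Require Import all_classical all_reals all_analysis.
From mathcomp Require Import measurable_realfun ring lra.

Import Order.TTheory GRing.Theory Num.Theory.
Import numFieldNormedType.Exports.

Local Open Scope ring_scope.

(** * Integrability of the logarithm near 0 *)

Section LnIntegrable.
Variable R : realType.
Local Notation mu := (@lebesgue_measure R).

(** The integrand has antiderivative [x * y + y - y * ln y]. *)
Lemma integral_sub_ln (x a : R) : 0 < a -> a < x ->
  (\int[mu]_(y in `[a, x]) (x - ln y)%:E =
    (x * x + x - x * ln x)%:E - (x * a + a - a * ln a)%:E)%E.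
Proof.
move=> a0 ax.
have dF (y : R) : 0 < y ->
    is_derive y 1 (fun y : R => x * y + y - y * ln y) (x - ln y).
  move=> y0; have dln := is_derive1_ln y0; apply: is_derive_eq.
  by rewrite /GRing.scale /= mulr1 mulfV ?gt_eqF //; ring.
have cF (y : R) : 0 < y ->
    {for y, continuous (fun y : R => x * y + y - y * ln y)}.
  by move=> /dF[? _]; apply/differentiable_continuous/derivable1_diffP.
apply: (@continuous_FTC2 _ _ (fun y : R => x * y + y - y * ln y)) => //.
- apply: continuous_in_subspaceT => y /[!inE] /=; rewrite in_itv /= => /andP[ay _].
  by apply: continuousB; [exact: cst_continuous|apply: continuous_ln; exact: lt_le_trans ay].
- split.
  + by move=> y; rewrite in_itv /= => /andP[ay _]; have [] := dF _ (lt_trans a0 ay).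
  + by apply: cvg_at_right_filter; apply: cF.
  + by apply: cvg_at_left_filter; apply: cF; exact: lt_trans ax.
- move=> y; rewrite in_itv /= => /andP[ay _].
  by rewrite derive1E; have [_ ->] := dF _ (lt_trans a0 ay).
Qed.

Lemma ln_le_bound (x y : R) : 0 < y -> y <= x -> ln y <= x.
Proof.
by move=> y0 yx; have := @le_ln1Dx R (y - 1); rewrite subrKC; move=> /(_ ltac:(lra)); lra.
Qed.

(** On []0, x]] the function [x - ln y] is nonnegative. Monotone convergence along the intervals
    [[x / (n + 1), x]], where its integral is explicit and bounded, makes it integrable; subtracting
    it from the constant [x] gives [ln]. *)
Lemma integrable_ln (x : R) : 0 < x -> mu.-integrable `[0, x] (EFin \o @ln R).
Proof.
move=> x0.
have mg (D : set R) : measurable D -> measurable_fun D (fun y : R => (x - ln y)%:E).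
  move=> mD; apply/measurable_EFinP/measurable_funB => //.
  exact: measurable_funTS.
have ig : mu.-integrable `[0, x] (fun y : R => (x - ln y)%:E).
  apply/integrableP; split; first exact: mg.
  rewrite -integral_itv_obnd_cbnd; last first.
    by apply/measurableT_comp => //; exact: mg.
  pose F n : set R := `[x / n.+1%:R, x]%classic.
  have FE : (`]0, x] = \bigcup_n F n)%classic.
    apply/seteqP; split => y /=.
      rewrite in_itv /= => /andP[y0 yx].
      (* This index [n] satisfies [x / y < n + 1], that is [x / (n + 1) < y]. *)
      exists (Num.truncn (x / y)) => //; rewrite /F /= in_itv /= yx andbT.
      rewrite ler_pdivrMr // mulrC -ler_pdivrMr //; apply/ltW.
      by apply: truncnS_gt.
    move=> [i _]; rewrite /F /= !in_itv /= => /andP[xy ->]; rewrite andbT.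
    by apply: lt_le_trans xy; rewrite divr_gt0.
  have mF i : measurable (F i) by exact: measurable_itv.
  have g0 i y : F i y -> 0 <= x - ln y.
    rewrite /F /= in_itv /= => /andP[xy yx]; rewrite subr_ge0 ln_le_bound //.
    by apply: lt_le_trans xy; rewrite divr_gt0.
  have ndF : {homo F : i j / (i <= j)%N >-> (i <= j)%O}.
    move=> i j ij; apply/subsetPset => y; rewrite /F /= !in_itv /= => /andP[xy ->].
    rewrite andbT; apply: le_trans xy.
    by rewrite ler_pM2l // lef_pV2 ?posrE // ler_nat ltnS.
  rewrite (@eq_integral _ _ _ mu _ (fun y : R => (x - ln y)%:E)); last first.
    by move=> y /set_mem; rewrite FE => -[i _] Fy; rewrite gee0_abs // lee_fin (g0 i).
  have cv : (\int[mu]_(y in F i) (x - ln y)%:E @[i --> \oo] -->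
      \int[mu]_(y in `]0%R, x]) (x - ln y)%:E)%E%classic.
    by rewrite FE; apply: ge0_nondecreasing_set_cvg_integral => // i; exact: mg.
  rewrite -(cvg_lim _ cv) //.
  apply: (@le_lt_trans _ _ (x * x + x - x * ln x)%:E); last exact: ltry.
  apply: lime_le; first by apply/cvg_ex; eexists; exact: cv.
  (* From [i = 1] on, the left endpoint [x / (i + 1)] lies strictly below [x]. *)
  exists 1%N => // i /= i1.
  set a := x / i.+1%:R.
  have a0 : 0 < a by rewrite divr_gt0.
  have ax : a < x by rewrite ltr_pdivrMr // ltr_pMr // ltr1n.
  rewrite /F integral_sub_ln // -EFinB lee_fin lerBlDr lerDl.
  (* The antiderivative is nonnegative at [a], so its value at [x] bounds every integral. *)
  have -> : x * a + a - a * ln a = a * (x - ln a) + a by ring.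
  have := ln_le_bound _ _ a0 (ltW ax).
  by rewrite -subr_ge0 => xa; rewrite addr_ge0 ?mulr_ge0 // ltW.
have -> : EFin \o @ln R = ((fun=> x%:E) \- (fun y => (x - ln y)%:E))%E.
  by apply/funext => y /=; rewrite -EFinB opprB addrC subrK.
apply: integrableB => //.
apply: continuous_compact_integrable; first exact: segment_compact.
by apply: continuous_subspaceT => y; exact: cst_continuous.
Qed.

End LnIntegrable.

(** * Polynomials under reversal of their coefficients *)

Section Reflection.
Variables (R : realType) (delta : nat).
Implicit Types (zeta : 'I_delta.+1 -> R) (x y : R).
Local Notation mu := (@lebesgue_measure R).
Local Notation P := dilog_poly.

Lemma horner_dilog_poly zeta x : (P zeta).[x] = \sum_s zeta s * x ^+ s.
Proof.
by rewrite horner_sum; apply: eq_bigr => s _; rewrite hornerZ hornerXn.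
Qed.

Lemma horner_deriv_dilog_poly zeta x :
  x * ((P zeta)^`()).[x] = \sum_(s < delta.+1) s%:R * (zeta s * x ^+ s).
Proof.
rewrite raddf_sum horner_sum mulr_sumr; apply: eq_bigr => s _.
rewrite /= derivZ hornerZ derivXn hornerMn hornerXn.
case: (nat_of_ord s) => [|j]; first by rewrite mulr0n !mul0r !mulr0.
by rewrite -mulr_natl exprS; ring.
Qed.

Lemma horner_reverse zeta x : x != 0 ->
  (P (reverse zeta)).[x^-1] = x ^- delta * (P zeta).[x].
Proof.
move=> x0; rewrite !horner_dilog_poly mulr_sumr (reindex_inj rev_ord_inj) /=.
apply: eq_bigr => s _; rewrite /reverse rev_ordK /= subSS exprVn.
have sd : (s <= delta)%N by rewrite -ltnS.
have e : x ^+ delta = x ^+ (delta - s) * x ^+ s by rewrite -exprD subnK.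
rewrite e; field.
by rewrite !expf_neq0.
Qed.

(** The operator [x * d/dx] multiplies the term of degree [s] by [s]; reversal turns this weight
    into [delta - s]. *)
Lemma horner_deriv_reverse zeta x : x != 0 ->
  x^-1 * ((P (reverse zeta))^`()).[x^-1] =
    x ^- delta * (delta%:R * (P zeta).[x] - x * ((P zeta)^`()).[x]).
Proof.
move=> x0; rewrite !horner_deriv_dilog_poly horner_dilog_poly.
rewrite [delta%:R * _]mulr_sumr -sumrB mulr_sumr (reindex_inj rev_ord_inj) /=.
apply: eq_bigr => s _; rewrite /reverse rev_ordK /= subSS exprVn.
have sd : (s <= delta)%N by rewrite -ltnS.
have e : x ^+ delta = x ^+ (delta - s) * x ^+ s by rewrite -exprD subnK.
rewrite natrB // e; field.
by rewrite !expf_neq0.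
Qed.

(** * Integrability, derivative and limit at 0 of the dilogarithm *)

Section Admissible.
Variable zeta : 'I_delta.+1 -> R.
Hypotheses (zeta0 : zeta ord0 = 1) (zeta_ge0 : forall s, 0 <= zeta s).

Lemma dilog_poly_ge1 y : 0 <= y -> 1 <= (P zeta).[y].
Proof.
move=> y0; rewrite horner_dilog_poly big_ord_recl zeta0 expr0 mulr1 lerDl.
by apply: sumr_ge0 => s _; rewrite mulr_ge0 ?exprn_ge0.
Qed.

Definition dilog_integrand y : R :=
  ln (P zeta).[y] / y - ln y / (P zeta).[y] * ((P zeta)^`()).[y].

(** Separates [ln y], integrable near 0, from the logarithmic derivative of the polynomial,
    continuous for [y >= 0]. *)
Lemma dilog_integrandE : dilog_integrand =
  (fun y => ln (P zeta).[y] / y - ln y * (((P zeta)^`()).[y] / (P zeta).[y])).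
Proof. by apply/funext => y; rewrite /dilog_integrand mulrAC mulrA. Qed.

Lemma integrable_horner (p : {poly R}) x : mu.-integrable `[0, x] (EFin \o horner p).
Proof.
apply: continuous_compact_integrable; first exact: segment_compact.
by apply: continuous_subspaceT; exact: continuous_horner.
Qed.

Lemma continuous_ln_dilog_poly_div y : 0 < y ->
  {for y, continuous (fun y => ln (P zeta).[y] / y)}.
Proof.
move=> y0; have P1 := dilog_poly_ge1 _ (ltW y0).
apply: continuousM; last by apply: inv_continuous; rewrite gt_eqF.
by apply: continuous_comp; [exact: continuous_horner|apply: continuous_ln; lra].
Qed.

Lemma continuous_log_deriv y : 0 <= y ->
  {for y, continuous (fun y => ((P zeta)^`()).[y] / (P zeta).[y])}.
Proof.
move=> y0; have P1 := dilog_poly_ge1 _ y0.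
apply: continuousM; first exact: continuous_horner.
apply: continuousV; last exact: continuous_horner.
by rewrite gt_eqF //; lra.
Qed.

Lemma continuous_dilog_integrand y : 0 < y -> {for y, continuous dilog_integrand}.
Proof.
move=> y0; rewrite dilog_integrandE; apply: continuousB.
  exact: continuous_ln_dilog_poly_div.
by apply: continuousM; [exact: continuous_ln|exact/continuous_log_deriv/ltW].
Qed.

(** Since [P - 1] vanishes at 0, it is [q * 'X] for a polynomial [q]; then
    [0 <= ln P(y) <= P(y) - 1] bounds the quotient by [q(y)] for [y > 0]. *)
Lemma integrable_ln_dilog_poly_div x :
  mu.-integrable `[0, x] (fun y => (ln (P zeta).[y] / y)%:E).
Proof.
have /factor_theorem[q qE] : root (P zeta - 1%:P) 0.
  rewrite rootE hornerD hornerN hornerC horner_dilog_poly big_ord_recl.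
  rewrite zeta0 expr0 mulr1 big1 ?addr0 ?subrr // => s _.
  by rewrite expr0n mulr0.
apply: (le_integrable _ _ _ (integrable_horner q x)) => //.
  (* Measurability is only to be checked on []0, x]], where the quotient is continuous. *)
  apply/measurable_EFinP/measurable_fun_itv_obnd_cbndP.
  apply: subspace_continuous_measurable_fun => //.
  apply: continuous_in_subspaceT => y /[!inE] /=; rewrite in_itv /= => /andP[y0 _].
  exact: continuous_ln_dilog_poly_div.
move=> y /=; rewrite in_itv /= lee_fin => /andP[y0 _].
(* At [y = 0] the quotient is 0 by the convention on division. *)
have [->|yn0] := eqVneq y 0; first by rewrite invr0 mulr0 normr0.
have {yn0}y0 : 0 < y by rewrite lt_neqAle eq_sym yn0.
have P1 := dilog_poly_ge1 _ (ltW y0).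
rewrite ger0_norm ?divr_ge0 ?ln_ge0 ?(ltW y0) //.
apply: le_trans (ler_norm _); rewrite ler_pdivrMr //.
have := congr1 (horner^~ y) qE.
rewrite hornerM !hornerD !hornerN !hornerC hornerX subr0 => <-.
by have := @le_ln1Dx R ((P zeta).[y] - 1); rewrite subrKC; apply; lra.
Qed.

(** The second summand is the integrable [ln] times a function continuous, hence bounded, on a
    compact interval. *)
Lemma integrable_dilog_integrand x : 0 < x ->
  mu.-integrable `[0, x] (EFin \o dilog_integrand).
Proof.
move=> x0; pose h y := ((P zeta)^`()).[y] / (P zeta).[y].
have ch : {within `[0, x], continuous h}%classic.
  apply: continuous_in_subspaceT => y /[!inE] /=; rewrite in_itv /= => /andP[y0 _].
  exact: continuous_log_deriv.
have -> : EFin \o dilog_integrand = ((fun y => (ln (P zeta).[y] / y)%:E) \-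
    ((EFin \o @ln R) \* (EFin \o h)))%E.
  by rewrite dilog_integrandE.
apply: integrableB => //; first exact: integrable_ln_dilog_poly_div.
apply: integrableMl => //; first exact: integrable_ln.
  exact: subspace_continuous_measurable_fun.
have /compact_bounded[M [Mr MP]] := continuous_compact ch (@segment_compact R 0 x).
by exists M; split => // N /MP bN y yx; apply: bN; exists y.
Qed.

Lemma is_derive_dilog x : 0 < x -> is_derive x 1 (dilog zeta) (2^-1 * dilog_integrand x).
Proof.
move=> x0.
(* Integrating up to [x + 1] makes [x] an interior point. *)
have [dF dFE] := continuous_FTC1_closed (ltr_pwDr ltr01 (lexx x))
  (integrable_dilog_integrand _ (addr_gt0 x0 ltr01)) x0
  (continuous_dilog_integrand _ x0).
have dF' : is_derive x 1 (fun x => \int[mu]_(y in `[0, x]) dilog_integrand y)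
    (dilog_integrand x).
  by apply: DeriveDef; [exact: dF|rewrite -derive1E; exact: dFE].
by rewrite /dilog; apply: is_deriveZ.
Qed.

(** Makes the reversed term of the reflection formula vanish as its argument [y^-1] tends to 0. *)
Lemma dilog_cvg0 : (dilog zeta x @[x --> 0] --> 0)%classic.
Proof.
have := cvgM (cvg_cst (2^-1 : R))
  (parameterized_integral_cvg_left ltr01 (integrable_dilog_integrand _ ltr01)).
by rewrite mulr0; apply.
Qed.

End Admissible.

(** * The reflection formula *)

Lemma dilog_integrand_reverse zeta x :
  zeta ord0 = 1 -> (forall s, 0 <= zeta s) -> 0 < x ->
  dilog_integrand (reverse zeta) x^-1 / x = dilog_integrand zeta x * x.
Proof.
move=> zeta0 zeta_ge0 x0; have xn0 : x != 0 by rewrite gt_eqF.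
have P1 := dilog_poly_ge1 _ zeta0 zeta_ge0 _ (ltW x0).
have P0 : 0 < (P zeta).[x] by lra.
have Pn0 : (P zeta).[x] != 0 by rewrite gt_eqF.
have xd0 : 0 < x ^+ delta by rewrite exprn_gt0.
have xdn0 : x ^+ delta != 0 by rewrite gt_eqF.
have dE : ((P (reverse zeta))^`()).[x^-1] =
    x * (x ^- delta * (delta%:R * (P zeta).[x] - x * ((P zeta)^`()).[x])).
  by rewrite -horner_deriv_reverse // mulVKf.
rewrite /dilog_integrand dE horner_reverse // lnM ?posrE ?invr_gt0 //.
rewrite !lnV ?posrE // lnXn // -mulr_natl.
(* The term [delta * ln x] arises once from the logarithm of [x ^- delta] and once, with opposite
   sign, from the derivative of the reversed polynomial; the two cancel. *)
by field; rewrite xn0 Pn0 xdn0.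
Qed.

Lemma dilog_reflection zeta x :
  zeta ord0 = 1 -> zeta ord_max = 1 -> (forall s, 0 <= zeta s) -> 0 < x ->
  dilog zeta x + dilog (reverse zeta) x^-1 = dilog_infty zeta.
Proof.
move=> zeta0 zetad zeta_ge0 x0.
(* The last coefficient becomes the constant one, so the results above apply to [reverse zeta]
   too. *)
have rev0 : reverse zeta ord0 = 1.
  by rewrite /reverse -zetad; congr zeta; apply: val_inj; rewrite /= subSS subn0.
have rev_ge0 s : 0 <= reverse zeta s by exact: zeta_ge0.
(* In the exponential coordinate [h] is differentiable on the whole line, where a zero derivative
   forces constancy. *)
pose h (t : R) := dilog zeta (expR t) + dilog (reverse zeta) (expR (- t)).
have dh (t : R) : is_derive t 1 h 0.
  have d1 := is_derive1_comp (is_derive_dilog _ zeta0 zeta_ge0 _ (expR_gt0 t))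
    (is_derive_expR t).
  have dN : is_derive t 1 (fun t : R => expR (- t)) (- expR (- t)).
    by apply: is_derive_eq; rewrite /GRing.scale /= mulrN1.
  have d2 := @is_derive1_comp _ _ (fun t : R => expR (- t)) _ _ _ (is_derive_dilog _ rev0 rev_ge0 _ (expR_gt0 (- t))) dN.
  apply: is_derive_eq (is_deriveD d1 d2) _.
  have := dilog_integrand_reverse zeta _ zeta0 zeta_ge0 (expR_gt0 t).
  rewrite -expRN => e; rewrite mulrN -!mulrA e; exact: subrr.
have hE y : 0 < y -> h (ln y) = dilog zeta y + dilog (reverse zeta) y^-1.
  by move=> y0; rewrite /h expRN lnK.
rewrite -hE //; apply/esym/cvg_lim => //.
have cV : (dilog (reverse zeta) y^-1 @[y --> +oo] --> 0)%classic.
  apply: (cvg_comp _ _ _ (dilog_cvg0 _ rev0 rev_ge0)).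
  apply/gtr0_cvgV0; first exact: nbhs_pinfty_gt.
  exact: cvg_id.
(* As [h] is constant, this difference equals [dilog zeta y] for [y > 0]. *)
have cB : (h (ln x) - dilog (reverse zeta) y^-1 @[y --> +oo] --> h (ln x))%classic.
  by have := cvgB (cvg_cst (h (ln x))) cV; rewrite subr0; apply.
apply: cvg_trans cB.
apply: near_eq_cvg; near=> y.
have y0 : 0 < y by near: y; exact: nbhs_pinfty_gt.
by rewrite /= (is_derive_0_is_cst (ln x) (ln y) dh) hE // addrK.
Unshelve. all: by end_near. Qed.

End Reflection.

(** * Semifield homomorphisms, endpoints of mutated tuples and the equivalence *)

Lemma semifield_hom1 (S T : semifieldType) (f : S -> T) :
  semifield_hom f -> f 1%g = 1%g.
Proof. by move=> [fM _]; apply: (mulgI (f 1%g)); rewrite -fM !mulg1. Qed.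

Lemma semifield_homV (S T : semifieldType) (f : S -> T) (a : S) :
  semifield_hom f -> f (a^-1)%g = ((f a)^-1)%g.
Proof.
move=> hf; apply: (mulgI (f a)); rewrite -(proj1 hf) !mulgV.
exact: semifield_hom1.
Qed.

(** A mutation keeps each tuple or reverses it, and reversal exchanges the two endpoints. *)
Lemma mutate_z_ends (n : nat) (d : 'I_n -> nat) (S : semifieldType) (k : 'I_n)
    (s : seed d S) :
  (forall i, seed_z s i ord0 = 1%g /\ seed_z s i ord_max = 1%g) ->
  forall i, seed_z (mutate k s) i ord0 = 1%g /\
            seed_z (mutate k s) i ord_max = 1%g.
Proof.
move=> ends i; rewrite /= /mutate_z; case: ifP => _; last exact: ends.
have -> : rev_ord (@ord0 (d i)) = ord_max by apply: val_inj; rewrite /= subSS subn0.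
have -> : rev_ord (@ord_max (d i)) = ord0 by apply: val_inj; rewrite /= subnn.
by have [] := ends i.
Qed.

Theorem theorem4p8 (R : realType) (n : nat) (d : 'I_n -> nat) (m : nat)
    (k : 'I_m -> 'I_n) (seeds : nat -> seed d (Qyz d)) (sigma : 'S_n)
    (r : 'I_n -> nat) (pi : Qyz d -> trop (yzvar d))
    (phi : Qyz d -> posreal R) :
  (0 < n)%N ->
  (forall i, (0 < d i)%N) ->
  is_seed (seeds 0%N) ->
  (forall i, seed_y (seeds 0%N) i = ygen d i) ->
  (forall i s, seed_z (seeds 0%N) i s = zgen s) ->
  (forall t : 'I_m, seeds t.+1 = mutate (k t) (seeds t)) ->
  sigma_periodic sigma (seeds 0%N) (seeds m) ->
  (forall t : nat, (t <= m)%N -> skew_symmetrizer r (seed_B (seeds t))) ->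
  is_tropicalization pi ->
  semifield_hom phi ->
  (forall i, generic_condition (fun s => phi (zgen (i := i) s) : R)) ->
  let r_tilde i : R := ((\big[lcmn/1%N]_j r j) %/ r i)%N%:R in
  let yk (t : 'I_m) := seed_y (seeds t) (k t) in
  let zk (t : 'I_m) := seed_z (seeds t) (k t) in
  let eps (t : 'I_m) := tropical_sign pi (yk t) in
  let zk_circ (t : 'I_m) :=
    if eps t == 1 then zk t else reverse (zk t) in
  (\sum_(t < m) r_tilde (k t)
       * dilog (fun s => phi (zk t s) : R) (phi (yk t))
   = \sum_(t < m) r_tilde (k t) * ((1 - (eps t)%:~R) / 2)
       * dilog_infty (fun s => phi (zk t s) : R))
  <->
  (\sum_(t < m) (eps t)%:~R * r_tilde (k t)
       * dilog (fun s => phi (zk_circ t s) : R) (phi (gexpz (yk t) (eps t)))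
   = 0).
Proof.
move=> _ _ [_ _ ends0] _ _ mut _ _ _ hphi _ r_tilde yk zk eps zk_circ.
have ends (t : nat) : (t <= m)%N ->
    forall i, seed_z (seeds t) i ord0 = 1%g /\ seed_z (seeds t) i ord_max = 1%g.
  elim: t => [|t IH] tm; first exact: ends0.
  by rewrite (mut (Ordinal tm)); apply: mutate_z_ends; apply/IH/ltnW.
have term t : r_tilde (k t) * dilog (fun s => phi (zk t s) : R) (phi (yk t)) -
    r_tilde (k t) * ((1 - (eps t)%:~R) / 2) *
      dilog_infty (fun s => phi (zk t s) : R) =
    (eps t)%:~R * r_tilde (k t) *
      dilog (fun s => phi (zk_circ t s) : R) (phi (gexpz (yk t) (eps t))).
  rewrite /zk_circ; have [->|->] : eps t = 1 \/ eps t = -1.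
  - by rewrite /eps /tropical_sign; case: ifP => _; [left|right].
  (* For sign 1 the coefficient of [dilog_infty] is 0. *)
  - by rewrite eqxx /= expg1 subrr mul0r mulr0 mul0r subr0 mul1r.
  have [z0 zd] := ends t (ltnW (ltn_ord t)) (k t).
  (* For sign -1 that coefficient is [r_tilde (k t)]; reflection cancels the dilogarithm at
     [phi (yk t)] and leaves minus the reversed one at its inverse. *)
  rewrite -(@dilog_reflection R _ (fun s => phi (zk t s) : R) (phi (yk t))) /=.
  - rewrite expg1 semifield_homV //= /reverse; lra.
  - by rewrite /zk z0 semifield_hom1.
  - by rewrite /zk zd semifield_hom1.
  - by move=> s; apply/ltW/posreal_gt0.
  - exact: posreal_gt0.
(* The second sum is the difference of the two sides of the first identity. *)
rewrite -(eq_bigr _ (fun t _ => term t)) sumrB.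
by split=> [->|/eqP]; [rewrite subrr|rewrite subr_eq0 => /eqP].
Qed.
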